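(* Let $\gamma_- <0< \gamma_+$ be real constants, let $f$ be a function, not identically zero, that is $C^1$ on $[\gamma_-,\gamma_+]$ and satisfies $f(\gamma_-)=f(0)=f(\gamma_+)=0$, and suppose the initial datum satisfies $\gamma_-\le \phi_0\le \gamma_+$. Suppose the time step $\Delta t>0$ satisfies $$\Delta t \max_{\gamma_-\le u\le \gamma_+} f'(u)\le 1 .$$ Let $(\phi_j^n)_{1\le j\le J,\ n\ge 0}$ be the solution of the semi-implicit scheme $$\frac{\phi_j^{n+1}-\phi_j^n}{\Delta t}=\varepsilon^2\nabla_+\nabla_-\phi_j^{n+1}-f(\phi_j^n),\qquad 1\le j\le J,\ n\ge 0,$$ with periodic boundary conditions and initial values $\phi_j^0=\phi_0(x_j)$. Then for all $n\ge 0$ $$\|\phi^{n+1}\|_1\le e^{L\Delta t}\|\phi^n\|_1,\qquad\text{where } L=-\min_{\gamma_-\le u\le\gamma_+}f'(u)\ \text{ and }\ \|\phi^n\|_1=\sum_{j=1}^J|\phi_j^n|\,\Delta x .$$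
   Context: The scheme discretizes the Allen-Cahn equation $\partial_t\phi=\varepsilon^2\Delta\phi-f(\phi)$, $\phi(x,0)=\phi_0(x)$, in one space dimension. Here $\varepsilon>0$ is a constant, $J\ge 1$ is the number of spatial grid points $x_1,\dots,x_J$ of a uniform grid with mesh size $\Delta x>0$, and $\Delta t>0$ is the time step; all quantities are real. The difference operators are $$\nabla_+u_j=\frac{u_{j+1}-u_j}{\Delta x},\qquad \nabla_-u_j=\frac{u_j-u_{j-1}}{\Delta x}.$$ Periodic boundary conditions mean that indices are understood modulo $J$, i.e. $\phi_0^n=\phi_J^n$ and $\phi_{J+1}^n=\phi_1^n$ (here $\phi_0^n$ is the grid value with index $0$, not the initial function $\phi_0$). The derivatives of $f$ at the endpoints of $[\gamma_-,\gamma_+]$ are one-sided if $f$ is defined only on that interval; values of $f$ outside the interval play no role in the hypotheses. *)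

(* Defs.v *)
From HB Require Import structures.
From mathcomp Require Import all_boot all_order all_algebra.
From mathcomp Require Import all_classical all_reals all_analysis.

Set Implicit Arguments.
Unset Strict Implicit.
Unset Printing Implicit Defensive.

Import Order.TTheory GRing.Theory Num.Theory.
Import numFieldNormedType.Exports.

Local Open Scope classical_set_scope.
Local Open Scope ring_scope.

(* The difference quotient [(f y - f x) / (y - x)] is taken along [y] in [A]
   only: at an interior point of [A] this is the usual derivative, at an
   endpoint of an interval it is the one-sided one. *)
Definition derivable_within (R : realType) (A : set R) (f : R -> R) (x : R) :
    Prop :=
  cvg ((fun y => (f y - f x) / (y - x)) @ within A x^').

Definition derive_within (R : realType) (A : set R) (f : R -> R) (x : R) : R :=
  lim ((fun y => (f y - f x) / (y - x)) @ within A x^').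

Definition C1_on (R : realType) (A : set R) (f : R -> R) : Prop :=
  (forall x, A x -> derivable_within A f x) /\
  {within A, continuous (derive_within A f)}.

(* For [f] of class C^1 on a nonempty compact interval these are an attained
   maximum and minimum, see [max_derive_attained] and [min_derive_attained]. *)
Definition max_derive (R : realType) (A : set R) (f : R -> R) : R :=
  sup (derive_within A f @` A).

Definition min_derive (R : realType) (A : set R) (f : R -> R) : R :=
  inf (derive_within A f @` A).

Lemma max_derive_attained (R : realType) (a b : R) (f : R -> R) :
  a <= b -> C1_on `[a, b] f ->
  (exists2 u, u \in `[a, b] &
     max_derive `[a, b] f = derive_within `[a, b] f u) /\
  (forall u, u \in `[a, b] ->
     derive_within `[a, b] f u <= max_derive `[a, b] f).
Proof.
move=> ab [_ cf]; have [c cab cmax] := EVT_max ab cf.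
have ubE : ubound (derive_within `[a, b] f @` `[a, b])
    (derive_within `[a, b] f c).
  by move=> _ [u uab <-]; exact: cmax.
have inE : (derive_within `[a, b] f @` `[a, b]) (derive_within `[a, b] f c).
  by exists c.
have -> : max_derive `[a, b] f = derive_within `[a, b] f c.
  apply/eqP; rewrite eq_le; apply/andP; split.
    by apply: ge_sup => //; exists (derive_within `[a, b] f c).
  by apply: ub_le_sup => //; exists (derive_within `[a, b] f c).
by split; [exists c|].
Qed.

Lemma min_derive_attained (R : realType) (a b : R) (f : R -> R) :
  a <= b -> C1_on `[a, b] f ->
  (exists2 u, u \in `[a, b] &
     min_derive `[a, b] f = derive_within `[a, b] f u) /\
  (forall u, u \in `[a, b] ->
     min_derive `[a, b] f <= derive_within `[a, b] f u).
Proof.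
move=> ab [_ cf]; have [c cab cmin] := EVT_min ab cf.
have lbE : lbound (derive_within `[a, b] f @` `[a, b])
    (derive_within `[a, b] f c).
  by move=> _ [u uab <-]; exact: cmin.
have inE : (derive_within `[a, b] f @` `[a, b]) (derive_within `[a, b] f c).
  by exists c.
have -> : min_derive `[a, b] f = derive_within `[a, b] f c.
  apply/eqP; rewrite eq_le; apply/andP; split.
    by apply: ge_inf => //; exists (derive_within `[a, b] f c).
  by apply: lb_le_inf => //; exists (derive_within `[a, b] f c).
by split; [exists c|].
Qed.

(* Grid functions are indexed by ['I_J], the index [i] standing for the grid
   point number [i.+1].  [ordS] and [ord_pred] are the cyclic successor and
   predecessor of ['I_J], i.e. indices are taken modulo [J]. *)
Definition grid_point (R : realType) (J : nat) (x1 dx : R) (i : 'I_J) : R :=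
  x1 + i%:R * dx.

Definition fwd_diff (R : realType) (J : nat) (dx : R) (u : 'I_J -> R) :
    'I_J -> R :=
  fun j => (u (ordS j) - u j) / dx.

Definition bwd_diff (R : realType) (J : nat) (dx : R) (u : 'I_J -> R) :
    'I_J -> R :=
  fun j => (u j - u (ord_pred j)) / dx.

Definition semi_implicit_scheme (R : realType) (J : nat) (eps dx dt : R)
    (f : R -> R) (phi : nat -> 'I_J -> R) : Prop :=
  forall (n : nat) (j : 'I_J),
    (phi n.+1 j - phi n j) / dt =
    eps ^+ 2 * fwd_diff dx (bwd_diff dx (phi n.+1)) j - f (phi n j).

Definition norm1 (R : realType) (J : nat) (dx : R) (u : 'I_J -> R) : R :=
  \sum_(j < J) `|u j| * dx.

(* Main.v *)
Require Import Defs.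
From HB Require Import structures.
From mathcomp Require Import all_boot all_order all_algebra.
From mathcomp Require Import all_classical all_reals all_analysis.
From mathcomp Require Import ring lra.

(** One step of the scheme is [phi n.+1 = (I - r D)^-1 (g (phi n))], where [D]
    is the cyclic second difference, [r = dt * eps^2 / dx^2 >= 0], and
    [g u = u - dt * f u] is an explicit Euler step for [u' = - f u].

    The explicit step: since [dt * f' <= 1], the function [g] is nondecreasing
    on the interval from [gm] to [gp]; it fixes the three zeros [gm], [0], [gp]
    of [f].  Hence it maps that interval into itself ([explicit_step_itv]) and
    preserves signs, and as [f'] is bounded below by [m], the minimum of [f'] on that interval,
    [`|g u| <= (1 - m * dt) * `|u| <= expR (- m * dt) * `|u|]
    ([explicit_step_norm]).

    The implicit step: the off-diagonal entries of [I - r D] are nonpositive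
    and its rows and columns sum to 1.  The row sums give the maximum principle
    for its inverse ([resolvent_le]), the column sums its contractivity in the
    discrete L1 norm ([resolvent_norm1]).

    The maximum principle keeps every [phi n j] in that interval, which is where
    the bounds on [g] hold; the contraction combined with the pointwise bound
    on [g] gives the growth factor of the norm. *)

Import Order.TTheory GRing.Theory Num.Theory.
Import numFieldNormedType.Exports.

Local Open Scope classical_set_scope.
Local Open Scope ring_scope.

(** * One-sided derivatives *)

(** [f y] is [f x] plus the difference quotient times [y - x], which tends
    to 0. *)
Lemma derivable_within_cvg (R : realType) (A : set R) (f : R -> R) (x : R) :
  derivable_within A f x -> f y @[y --> within A (nbhs x)] --> f x.
Proof.
move=> /cvg_ex[l ql].
have cA : (fun y : R => y - x) @ within A x^' --> (0 : R).
  apply: cvg_trans (_ : (fun y : R => y - x) @ nbhs x --> (0 : R)).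
    apply: cvg_app; apply: cvg_trans (cvg_within _) (cvg_within _).
  rewrite -[X in _ --> X](subrr x); apply: cvgB; [exact: cvg_id|exact: cvg_cst].
have cf : f y @[y --> within A x^'] --> f x.
  have : f x + (f y - f x) / (y - x) * (y - x) @[y --> within A x^'] -->
      f x + l * 0.
    by apply: cvgD; [exact: cvg_cst|exact: cvgM].
  rewrite mulr0 addr0; apply: cvg_trans; apply: near_eq_cvg.
  apply: cvg_within; near=> y.
  have yx : y != x by near: y; exact: nbhs_dnbhs_neq.
  by rewrite divfK ?subr_eq0// addrC subrK.
move=> P Pfx; have : nbhs x (fun y => y != x -> A y -> P (f y)) := cf P Pfx.
apply: filterS => y H Ay; have [->|yx] := eqVneq y x; last exact: H.
exact: (nbhs_singleton (Pfx : nbhs (f x) P)).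
Unshelve. all: by end_near. Qed.

Lemma derivable_within_is_derive (R : realType) (A : set R) (f : R -> R)
    (x : R) :
  nbhs x A -> derivable_within A f x ->
  is_derive x 1 f (derive_within A f x).
Proof.
move=> Ax dfx.
have qx : (f y - f x) / (y - x) @[y --> x^'] --> derive_within A f x.
  move=> P /(dfx P) H.
  have {}H : nbhs x (fun y => y != x -> A y -> P ((f y - f x) / (y - x))) := H.
  by apply: (filterS2 _ _ H Ax) => y H' Ay /H'; exact.
have shiftx : h + x @[h --> (0 : R)^'] --> x^'.
  move=> P /= /nbhs_ballP [e /= e0 Pe]; apply/nbhs_ballP; exists e => //= h.
  rewrite /ball/= sub0r normrN => he h0; apply: Pe.
    by rewrite /ball/= opprD addrCA subrr addr0 normrN.
  by rewrite -subr_eq0 addrK.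
have qh : h^-1 *: ((f \o shift x) (h *: 1) - f x) @[h --> (0 : R)^'] -->
    derive_within A f x.
  have := cvg_comp _ _ shiftx qx; apply: cvg_trans; apply: near_eq_cvg.
  near=> h => /=.
  by rewrite addrK mulrC /GRing.scale/= mulr1.
by split; [apply/cvg_ex; eexists; exact: qh|exact: cvg_lim qh].
Unshelve. all: by end_near. Qed.

(** The mean value theorem, the derivative at the intermediate point being
    bounded by its extrema. *)
Lemma C1_on_increment (R : realType) (a b : R) (f : R -> R) (x y : R) :
  C1_on `[a, b] f -> a <= x -> x <= y -> y <= b ->
  min_derive `[a, b] f * (y - x) <= f y - f x <=
  max_derive `[a, b] f * (y - x).
Proof.
move=> Cf ax xy yb; have ab : a <= b := le_trans ax (le_trans xy yb).
have [_ maxf] := max_derive_attained ab Cf.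
have [_ minf] := min_derive_attained ab Cf.
have [df _] := Cf.
have xyab : `[x, y] `<=` `[a, b].
  by move=> z; rewrite /= !in_itv/= => /andP[xz zy];
    rewrite (le_trans ax xz) (le_trans zy yb).
have derf z : z \in `]x, y[ -> is_derive z 1 f (derive_within `[a, b] f z).
  rewrite in_itv/= => /andP[xz zy]; apply: derivable_within_is_derive.
    have : z \in `]a, b[ by rewrite in_itv/= (le_lt_trans ax)// (lt_le_trans zy).
    move=> /near_in_itvoo; apply: filterS => t.
    by rewrite /= !in_itv/= => /andP[/ltW -> /ltW ->].
  by apply: df; rewrite /= in_itv/= (ltW (le_lt_trans ax xz)) (ltW (lt_le_trans zy yb)).
have ctsf : {within `[x, y], continuous f}.
  apply: continuous_subspaceW xyab _.
  by apply/subspace_continuousP => z /df/derivable_within_cvg.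
have [c cxy ->] := MVT_segment xy derf ctsf.
have cab : c \in `[a, b] by move: (xyab c); rewrite /=; apply.
by rewrite !ler_wpM2r ?subr_ge0 ?minf ?maxf.
Qed.

(** * The explicit step *)

Lemma explicit_step_le (R : realType) (a b dt : R) (f : R -> R) (x y : R) :
  C1_on `[a, b] f -> 0 < dt -> dt * max_derive `[a, b] f <= 1 ->
  a <= x -> x <= y -> y <= b ->
  x - dt * f x <= y - dt * f y.
Proof.
move=> Cf dt0 hstep ax xy yb.
have /andP[_ fM] := C1_on_increment _ _ _ _ _ _ Cf ax xy yb.
have h1 : dt * (f y - f x) <= dt * (max_derive `[a, b] f * (y - x)).
  by rewrite ler_wpM2l// ltW.
have h2 : dt * max_derive `[a, b] f * (y - x) <= 1 * (y - x).
  by rewrite ler_wpM2r// subr_ge0.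
lra.
Qed.

Lemma explicit_step_itv (R : realType) (a b dt : R) (f : R -> R) (u : R) :
  C1_on `[a, b] f -> f a = 0 -> f b = 0 ->
  0 < dt -> dt * max_derive `[a, b] f <= 1 ->
  a <= u <= b -> a <= u - dt * f u <= b.
Proof.
move=> Cf fa fb dt0 hstep /andP[au ub].
have := explicit_step_le _ _ _ _ _ _ _ Cf dt0 hstep (lexx a) au ub.
have := explicit_step_le _ _ _ _ _ _ _ Cf dt0 hstep au ub (lexx b).
by rewrite fa fb mulr0 !subr0 => -> ->.
Qed.

(** The sign of [u] is kept by the monotonicity of the step and by [f 0 = 0],
    so the absolute values can be removed and [f u] compared with [m * u],
    where [m] is the minimum of the derivative; then
    [1 + x <= expR x]. *)
Lemma explicit_step_norm (R : realType) (a b dt : R) (f : R -> R) (u : R) :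
  C1_on `[a, b] f -> a <= 0 -> 0 <= b -> f 0 = 0 ->
  0 < dt -> dt * max_derive `[a, b] f <= 1 ->
  a <= u <= b ->
  `|u - dt * f u| <= expR (- min_derive `[a, b] f * dt) * `|u|.
Proof.
move=> Cf a0 b0 f0 dt0 hstep /andP[au ub].
set m := min_derive _ f.
apply: (@le_trans _ _ ((1 + - m * dt) * `|u|)); last first.
  by rewrite ler_wpM2r// expR_ge1Dx.
have [u0|/ltW u0] := leP 0 u.
- have /andP[mf _] := C1_on_increment _ _ _ _ _ _ Cf a0 u0 ub.
  have := explicit_step_le _ _ _ _ _ _ _ Cf dt0 hstep a0 u0 ub.
  move: mf; rewrite f0 mulr0 !subr0 -/m => mf g0.
  rewrite (ger0_norm u0) ger0_norm//.
  have : dt * (m * u) <= dt * f u by rewrite ler_wpM2l// ltW.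
  lra.
- have /andP[mf _] := C1_on_increment _ _ _ _ _ _ Cf au u0 b0.
  have := explicit_step_le _ _ _ _ _ _ _ Cf dt0 hstep au u0 b0.
  move: mf; rewrite f0 mulr0 !sub0r oppr0 -/m => mf g0.
  rewrite (ler0_norm u0) ler0_norm//.
  have : dt * (m * - u) <= dt * - f u by rewrite ler_wpM2l// ltW.
  lra.
Qed.

(** * The implicit diffusion step *)

(** At an index where [v] is maximal its cyclic second difference is
    nonpositive, so there [v] is at most [w]. *)
Lemma resolvent_le (R : realFieldType) (J : nat) (r c : R) (v w : 'I_J -> R) :
  0 <= r ->
  (forall j, v j - r * (v (ordS j) - v j - (v j - v (ord_pred j))) = w j) ->
  (forall j, w j <= c) -> forall j, v j <= c.
Proof.
move=> r0 vw wc j; case: (@arg_maxP _ _ _ j xpredT v) => // i _ imax.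
apply: le_trans (imax j isT) _; apply: le_trans (wc i); rewrite -vw.
have h1 := imax (ordS i) isT; have h2 := imax (ord_pred i) isT.
have : 0 <= r * ((v i - v (ordS i)) + (v i - v (ord_pred i))).
  by rewrite mulr_ge0// addr_ge0// subr_ge0.
lra.
Qed.

(** Move the off-diagonal terms to the right, take absolute values and sum over
    the cycle: both shifts are permutations of the indices, so the terms in [r]
    cancel. *)
Lemma resolvent_norm1 (R : realFieldType) (J : nat) (r : R)
    (v w : 'I_J -> R) :
  0 <= r ->
  (forall j, v j - r * (v (ordS j) - v j - (v j - v (ord_pred j))) = w j) ->
  \sum_j `|v j| <= \sum_j `|w j|.
Proof.
move=> r0 vw.
have key j : `|v j| * (1 + r *+ 2) <=
    `|w j| + r * `|v (ordS j)| + r * `|v (ord_pred j)|.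
  have -> : `|v j| * (1 + r *+ 2) = `|w j + r * v (ordS j) + r * v (ord_pred j)|.
    rewrite -[X in _ * X]ger0_norm ?addr_ge0 ?mulrn_wge0// -normrM -vw.
    by congr `|_|; ring.
  apply: le_trans (ler_normD _ _) _; rewrite [`|r * v (ord_pred j)|]normrM.
  rewrite (ger0_norm r0) lerD2r; apply: le_trans (ler_normD _ _) _.
  by rewrite normrM (ger0_norm r0).
have := ler_sum (index_enum 'I_J) (fun j (_ : true) => key j).
rewrite !big_split/= -mulr_suml -!mulr_sumr.
rewrite -(reindex_inj (@ordS_inj J) (F := fun j => `|v j|) (P := xpredT)).
rewrite -(reindex_inj (@ord_pred_inj J) (F := fun j => `|v j|) (P := xpredT)).
lra.
Qed.

(** * The scheme *)

Lemma semi_implicit_scheme_resolvent (R : realType) (J : nat)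
    (eps dx dt : R) (f : R -> R) (phi : nat -> 'I_J -> R) :
  0 < dx -> 0 < dt -> semi_implicit_scheme eps dx dt f phi ->
  forall n j, phi n.+1 j - dt * eps ^+ 2 / dx ^+ 2 *
      (phi n.+1 (ordS j) - phi n.+1 j -
        (phi n.+1 j - phi n.+1 (ord_pred j))) =
    phi n j - dt * f (phi n j).
Proof.
move=> dx0 dt0 hs n j; have dxn : dx != 0 by rewrite gt_eqF.
have dtn : dt != 0 by rewrite gt_eqF.
have := congr1 ( *%R^~ dt) (hs n j); rewrite /fwd_diff /bwd_diff ordSK/=.
rewrite divfK// => e.
have -> : phi n.+1 j = phi n j + (phi n.+1 j - phi n j) by ring.
rewrite {1}e; field.
exact: dxn.
Qed.

Theorem mainTheorem2 (R : realType) (gm gp : R) (f : R -> R)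
    (J : nat) (eps dx dt x1 : R) (Omega : set R) (phi0 : R -> R)
    (phi : nat -> 'I_J -> R)
    (hgm : gm < 0) (hgp : 0 < gp)
    (hf_nz : exists2 u, u \in `[gm, gp] & f u != 0)
    (hf_C1 : C1_on `[gm, gp] f)
    (hf_gm : f gm = 0) (hf_0 : f 0 = 0) (hf_gp : f gp = 0)
    (hJ : (1 <= J)%N) (heps : 0 < eps) (hdx : 0 < dx) (hdt : 0 < dt)
    (hgrid : forall j : 'I_J, Omega (grid_point x1 dx j))
    (hphi0 : forall x, Omega x -> gm <= phi0 x <= gp)
    (hstep : dt * max_derive `[gm, gp] f <= 1)
    (hinit : forall j : 'I_J, phi 0%N j = phi0 (grid_point x1 dx j))
    (hscheme : semi_implicit_scheme eps dx dt f phi) :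
  forall n : nat,
    norm1 dx (phi n.+1) <=
    expR (- min_derive `[gm, gp] f * dt) * norm1 dx (phi n).
Proof.
have hS := semi_implicit_scheme_resolvent _ _ _ _ _ _ _ hdx hdt hscheme.
have r0 : 0 <= dt * eps ^+ 2 / dx ^+ 2.
  by rewrite divr_ge0 ?mulr_ge0 ?sqr_ge0// ltW.
have inv n j : gm <= phi n j <= gp.
  elim: n j => [|n IH] j; first by rewrite hinit; exact/hphi0/hgrid.
  have hg i := explicit_step_itv _ _ _ _ _ _ hf_C1 hf_gm hf_gp hdt hstep (IH i).
  apply/andP; split; last first.
    by apply: (resolvent_le _ _ _ _ _ _ r0 (hS n)) => i; case/andP: (hg i).
  (* The lower bound is the maximum principle for the opposite functions. *)
  rewrite -lerN2; move: j.
  apply: (resolvent_le _ _ _ _ (fun j => - phi n.+1 j)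
    (fun j => - (phi n j - dt * f (phi n j))) r0) => i.
    by rewrite -hS; ring.
  by rewrite lerN2; case/andP: (hg i).
move=> n; rewrite /norm1 -!mulr_suml mulrA ler_wpM2r ?(ltW hdx)//.
apply: le_trans (resolvent_norm1 _ _ _ _ _ r0 (hS n)) _.
rewrite mulr_sumr; apply: ler_sum => j _.
exact: explicit_step_norm _ _ _ _ _ _ hf_C1 (ltW hgm) (ltW hgp) hf_0 hdt hstep (inv n j).
Qed.
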